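(* Let $(N,\underline X)\in\aleph^{FGM*}$, with associated symmetric Bernoulli sequence $\{I_j\}_{j\ge0}$ (so that $(I_0,\dots,I_n)$ is the vector associated with $C_n$), and let $K_n=I_1+\dots+I_n$. Then for $t\ge0$, $$\mathcal L_S(t)=\gamma_N(0)+\sum_{n=1}^\infty E\Big[\gamma_{N_{[1+I_0]}}(n)\prod_{j=1}^n\mathcal L_{X_{[1+I_j]}}(t)\Big]$$ $$\qquad=\gamma_N(0)+\sum_{i\in\{0,1\}}\sum_{n=1}^\infty\gamma_{N_{[1+i]}}(n)\sum_{k=0}^n\Pr(I_0=i,K_n=k)\,\mathcal L_{X_{[1]}}(t)^{n-k}\mathcal L_{X_{[2]}}(t)^k,$$ where the expectation in the first line is over $(I_0,\dots,I_n)$ and the sums over $n$ run over $n\le\sup A_N$.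
   Context: Collective risk model (CRM): $N$ is a random variable with values in $\mathbb{N}_0$, cdf $F_N$, pmf $\gamma_N(n)=\Pr(N=n)$ and support $A_N=\{n:\gamma_N(n)>0\}$; $\underline X=\{X_j\}_{j\ge1}$ is a sequence of identically distributed strictly positive random variables with common cdf $F_X$ (generic copy $X$); $S=\sum_{j\ge1}X_j\mathbb{1}_{\{N\ge j\}}$. $\mathcal L_Y(t)=E[e^{-tY}]$ is the Laplace–Stieltjes transform. A $d$-variate FGM copula with parameters $\theta_{j_1\dots j_k}$ is $C(u_1,\dots,u_d)=\prod_{m=1}^d u_m\big(1+\sum_{k=2}^d\sum_{j_1<\dots<j_k}\theta_{j_1\dots j_k}\bar u_{j_1}\cdots\bar u_{j_k}\big)$, $\bar u=1-u$, with parameters such that $1+\sum_{k}\sum_{j_1<\dots<j_k}\theta_{j_1\dots j_k}\varepsilon_{j_1}\cdots\varepsilon_{j_k}\ge0$ for all $\varepsilon\in\{-1,1\}^d$. To it is associated the random vector $\boldsymbol I$ on $\{0,1\}^d$ with pmf $f_{\boldsymbol I}(\boldsymbol i)=2^{-d}\big(1+\sum_{k=2}^d\sum_{j_1<\dots<j_k}(-1)^{i_{j_1}+\dots+i_{j_k}}\theta_{j_1\dots j_k}\big)$ (components Bernoulli$(1/2)$). A CRM belongs to $\aleph^{FGM}$ if for every $k\in\mathbb{N}_1$, $k\le\sup A_N$, $F_{N,X_1,\dots,X_k}(n,x_1,\dots,x_k)=C_k(F_N(n),F_X(x_1),\dots,F_X(x_k))$ for a $(k+1)$-variate FGM copula $C_k$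 with coordinates indexed $0,\dots,k$ (index $0$ for $N$); the associated vectors $(I_0,\dots,I_k)$ are consistent and form a sequence $\{I_j\}_{j\ge0}$. It belongs to $\aleph^{FGM*}$ if in addition $(N,X_1,\dots,X_k)\overset d=(N,X_{\pi(1)},\dots,X_{\pi(k)})$ for all such $k$ and permutations $\pi$. For a random variable $Y$, $Y_{[1]}$, $Y_{[2]}$ denote the minimum and maximum of two iid copies of $Y$; $\gamma_{N_{[j]}}(n)=\Pr(N_{[j]}=n)$. *)

(* Defs.v *)
From HB Require Import structures.
From mathcomp Require Import all_boot all_order all_algebra.
From mathcomp Require Import all_classical all_reals all_analysis.
From mathcomp Require Import perm.
Set Implicit Arguments. Unset Strict Implicit. Unset Printing Implicit Defensive.
Import Order.TTheory GRing.Theory Num.Theory.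
Local Open Scope classical_set_scope.
Local Open Scope ring_scope.

Section FGM.
Variable R : realType.

(* FGM parameters: theta s, where s = [:: j1; ...; jm] is a strictly increasing
   list of coordinate indices (index 0 is N), stands for theta_{j1...jm}. *)

Definition idxs k (J : {set 'I_k}) : seq nat := [seq val j | j <- enum J].

Definition fgm_copula (theta : seq nat -> R) k (u : 'I_k.+1 -> R) : R :=
  (\prod_(m < k.+1) u m) *
  (1 + \sum_(J : {set 'I_k.+1} | (2 <= #|J|)%N)
         theta (idxs J) * \prod_(j in J) (1 - u j)).

Definition fgm_admissible (theta : seq nat -> R) k : Prop :=
  forall eps : {ffun 'I_k.+1 -> bool},
    0 <= 1 + \sum_(J : {set 'I_k.+1} | (2 <= #|J|)%N)
               theta (idxs J) * \prod_(j in J) (if eps j then -1 else 1).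

Definition fgm_pmf (theta : seq nat -> R) n (i : {ffun 'I_n.+1 -> bool}) : R :=
  (2 ^- n.+1) *
  (1 + \sum_(J : {set 'I_n.+1} | (2 <= #|J|)%N)
         (-1) ^+ (\sum_(j in J) (i j : nat))%N * theta (idxs J)).

Definition fgm_PrIK (theta : seq nat -> R) n (b : bool) (k : nat) : R :=
  \sum_(i : {ffun 'I_n.+1 -> bool} |
          (i ord0 == b) && ((\sum_(j < n.+1 | j != ord0) (i j : nat))%N == k))
     fgm_pmf theta i.

End FGM.

Section CRM.
Context d (T : measurableType d) (R : realType) (P : probability T R).
Variables (N : T -> nat) (X : nat -> T -> R).

Definition gammaN (n : nat) : R := fine (P (N @^-1` [set n])).
Definition cdfN (n : nat) : R := fine (P [set w | (N w <= n)%N]).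
Definition cdfX (x : R) : R := fine (P [set w | X 1 w <= x]).

(* k <= sup A_N, with A_N = {n | Pr(N = n) > 0} *)
Definition le_supAN (k : nat) : Prop := exists n, (k <= n)%N /\ 0 < gammaN n.

Definition jointcdf k (n : nat) (x : 'I_k -> R) : R :=
  fine (P [set w | (N w <= n)%N /\ forall j : 'I_k, X j.+1 w <= x j]).

Definition jointcdf_perm k (pi : {perm 'I_k}) (n : nat) (x : 'I_k -> R) : R :=
  fine (P [set w | (N w <= n)%N /\ forall j : 'I_k, X (pi j).+1 w <= x j]).

Definition margvec k (n : nat) (x : 'I_k -> R) (m : 'I_k.+1) : R :=
  if unlift ord0 m is Some j then cdfX (x j) else cdfN n.

Definition aggS (w : T) : R := \sum_(j < N w) X j.+1 w.

Definition LS (t : R) : \bar R := (\int[P]_w (expR (- t * aggS w))%:E)%E.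

(* N_[1], N_[2]: min / max of two iid copies of N, realized on (T*T, P x P);
   b = false gives N_[1], b = true gives N_[2] *)
Definition gammaNord (b : bool) (n : nat) : R :=
  fine ((P \x P)%E [set w : T * T |
     (if b then maxn (N w.1) (N w.2) else minn (N w.1) (N w.2)) = n]).

Definition LXord (b : bool) (t : R) : R :=
  fine (\int[(P \x P)%E]_w
     (expR (- t * (if b then Num.max (X 1 w.1) (X 1 w.2)
                         else Num.min (X 1 w.1) (X 1 w.2))))%:E)%E.

End CRM.

(* Main.v *)
Require Import Defs.
From HB Require Import structures.
From mathcomp Require Import all_boot all_order all_algebra.
From mathcomp Require Import all_classical all_reals all_analysis.
From mathcomp Require Import perm measurable_realfun zify ring lra.
Import Order.TTheory GRing.Theory Num.Theory numFieldNormedType.Exports.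
Local Open Scope classical_set_scope.
Local Open Scope ring_scope.

(** The FGM copula is a signed mixture, with weights [fgm_pmf], of products of
    the cdfs [u (2 - u)] and [u ^ 2] of the minimum and maximum of two iid
    uniforms.  Hence P(N = n, X_1 <= x_1, ..., X_n <= x_n) is the same mixture
    of product probabilities of order statistics.  By multilinearity the
    identity extends from the indicators of {X_j <= x_j} to linear combinations of them,
    and by dominated convergence to the bounded limits exp(-t X_j), because the
    superlevel sets of exp(-t x) are of the form {x <= a}.  Summing over the
    values of N gives the first formula; grouping the mixture by I_0 and K_n
    gives the second. *)

(** * Mixture form of the FGM copula *)

(* cdf at a point of level u of the minimum (b = false) or maximum (b = true)
   of two independent copies. *)
Definition ordcdf {R : realType} (b : bool) (u : R) : R :=
  u * (1 + (-1) ^+ b * (1 - u)).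

Lemma sum_ffun_bool_prod (R : comPzRingType) (I : finType)
    (F : I -> bool -> R) :
  \sum_(i : {ffun I -> bool}) \prod_m F m (i m) =
  \prod_m (F m true + F m false).
Proof.
rewrite -(bigA_distr_bigA F).
by apply: eq_bigr => m _; rewrite big_bool.
Qed.

(** The sum factorizes over the coordinates: one outside [J] contributes (1 + v) + (1 - v) = 2, one
    in [J] contributes (1 + v) - (1 - v) = 2 v. *)
Lemma sum_sign_prod (R : comPzRingType) (I : finType) (v : I -> R)
    (J : {set I}) :
  \sum_(i : {ffun I -> bool})
     (-1) ^+ (\sum_(j in J) (i j : nat))%N * \prod_m (1 + (-1) ^+ i m * v m) =
  2 ^+ #|I| * \prod_(j in J) v j.
Proof.
pose F m (b : bool) : R :=
  (if m \in J then (-1) ^+ b else 1) * (1 + (-1) ^+ b * v m).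
transitivity (\sum_(i : {ffun I -> bool}) \prod_m F m (i m)).
  apply: eq_bigr => i _; rewrite big_split/= -big_mkcond/=.
  by rewrite expr_sum.
rewrite sum_ffun_bool_prod -prodr_const (big_mkcond (mem J)) -big_split/=.
by apply: eq_bigr => m _; rewrite /F; case: ifP => _; rewrite expr1 expr0; ring.
Qed.

(** After [\prod_m u m] is factored out, [sum_sign_prod] with v = 1 - u turns each sign in [fgm_pmf]
    into the product over [J], and the resulting 2 ^ (k + 1) cancels the normalization. *)
Lemma fgm_copula_mixture (R : realType) (theta : seq nat -> R) k
    (u : 'I_k.+1 -> R) :
  fgm_copula theta u =
  \sum_(i : {ffun 'I_k.+1 -> bool})
     fgm_pmf theta i * \prod_m ordcdf (i m) (u m).
Proof.
pose V (i : {ffun 'I_k.+1 -> bool}) := \prod_m (1 + (-1) ^+ i m * (1 - u m)).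
pose s (J : {set 'I_k.+1}) (i : {ffun 'I_k.+1 -> bool}) : R :=
  (-1) ^+ (\sum_(j in J) (i j : nat))%N.
have sV J : \sum_i s J i * V i = 2 ^+ k.+1 * \prod_(j in J) (1 - u j).
  by rewrite sum_sign_prod card_ord.
have s0V : \sum_i V i = 2 ^+ k.+1.
  (* This is [sV] for the empty set, whose sign and product are both 1. *)
  rewrite -[RHS]mulr1 -[X in _ * X](big_set0 _ *%R (fun j => 1 - u j)) -sV.
  by apply: eq_bigr => i _; rewrite /s big_set0 mul1r.
transitivity (\prod_m u m * (2 ^- k.+1 * (\sum_i V i +
    \sum_(J : {set 'I_k.+1} | (2 <= #|J|)%N)
       theta (idxs J) * (\sum_i s J i * V i)))); last first.
  under [X in _ + X]eq_bigr do rewrite mulr_sumr.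
  rewrite exchange_big -big_split/= !mulr_sumr.
  apply: eq_bigr => i _; rewrite big_split/= -/(V i) /fgm_pmf.
  under [X in _ + X]eq_bigr do rewrite mulrA [theta _ * _]mulrC.
  by rewrite -mulr_suml /s; set c := 2 ^- _; set A := \sum_(_ | _) _; ring.
rewrite s0V; congr (_ * _).
under [in RHS]eq_bigr do rewrite sV mulrCA.
by rewrite -mulr_sumr -[X in _ * (X + _)]mulr1 -mulrDr mulrA mulVf ?mul1r//.
Qed.

(** The product depends on [i] only through the number of ones outside coordinate 0, so the vectors
    are grouped by [i ord0] and then by this number, the value of K_n. *)
Lemma sum_fgm_pmf_PrIK (R : realType) (theta : seq nat -> R) n
    (g : bool -> R) (a b : R) :
  \sum_(i : {ffun 'I_n.+1 -> bool})
     fgm_pmf theta i * g (i ord0) *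
     \prod_(j < n.+1 | j != ord0) (if i j then b else a) =
  \sum_(e : bool) g e *
     \sum_(k < n.+1) fgm_PrIK theta n e k * a ^+ (n - k) * b ^+ k.
Proof.
pose K (i : {ffun 'I_n.+1 -> bool}) := (\sum_(j < n.+1 | j != ord0) i j)%N.
have card0 : #|[pred j : 'I_n.+1 | j != ord0]| = n.
  by rewrite (cardC1 (ord0 : 'I_n.+1)) card_ord.
have Kn i : (K i < n.+1)%N.
  rewrite ltnS -[X in (_ <= X)%N]card0 -sum1_card.
  by apply: leq_sum => j _; exact: leq_b1.
rewrite (partition_big (fun i : {ffun 'I_n.+1 -> bool} => i ord0) xpredT)//=.
apply: eq_bigr => e _.
rewrite (partition_big (fun i => Ordinal (Kn i)) xpredT)//= mulr_sumr.
apply: eq_bigr => k _; rewrite /fgm_PrIK !mulr_suml mulr_sumr.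
apply: eq_big => [i|i /andP[/eqP <- /eqP <-]]; first by rewrite -val_eqE.
suff -> : \prod_(j < n.+1 | j != ord0) (if i j then b else a) =
    a ^+ (n - K i) * b ^+ K i.
  by set x := a ^+ _; set y := b ^+ _; rewrite -/(K i) -/x -/y; ring.
(* Written as powers, the factors multiply by adding exponents, which total n - K and K. *)
transitivity (\prod_(j < n.+1 | j != ord0) (a ^+ (1 - i j)%N * b ^+ i j)).
  by apply: eq_bigr => j _; case: (i j); rewrite /= ?mul1r ?mulr1.
rewrite big_split/= -!expr_sum; congr (_ ^+ _ * _ ^+ _) => /=.
rewrite sumnB; last by move=> j _; exact: leq_b1.
by rewrite sum1_card card0.
Qed.

(** * Events of order statistics and integration tools *)

Lemma fine_probabilityD d (T : measurableType d) (R : realType)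
    (P : probability T R) (A B : set T) :
  measurable A -> measurable B -> B `<=` A ->
  fine (P (A `\` B)) = fine (P A) - fine (P B).
Proof.
move=> mA mB BA; rewrite measureD ?ltey_eq ?fin_num_measure//.
by rewrite (setIidr BA) fineB ?fin_num_measure.
Qed.

(* With A = {Y <= x} these are the events {max <= x} and {min <= x} for two
   independent copies of Y. *)
Lemma probability_ordcdf d (T : measurableType d) (R : realType)
    (P : probability T R) (A : set T) (b : bool) : measurable A ->
  fine ((P \x P)%E [set w | if b then A w.1 /\ A w.2 else A w.1 \/ A w.2]) =
  ordcdf b (fine (P A)).
Proof.
move=> mA; rewrite /ordcdf; case: b.
  rewrite (_ : [set w | _] = A `*` A)//.
  rewrite product_measure1E// fineM ?fin_num_measure// expr1.
  by set p := fine _; ring.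
(* The union fails exactly when neither copy lies in [A], which is a product event. *)
rewrite (_ : [set w | _] = ~` (~` A `*` ~` A)); last first.
  apply/seteqP; split=> w /=; first by case=> Aw [] /[swap]//.
  by move=> /not_andP[] /contrapT; [left|right].
have mCA := measurableC mA.
rewrite probability_setC; last exact: measurableX.
transitivity (fine (1 - (1 - P A) * (1 - P A))%E).
  congr (fine (1 - _)%E); rewrite -probability_setC//.
  exact: product_measure1E.
rewrite -[P A]fineK ?fin_num_measure//= expr0.
by set p := fine _; ring.
Qed.

Lemma Rintegral_sum_indic d (T : measurableType d) (R : realType)
    (P : probability T R) (D : set T) (I : finType) (c : I -> R)
    (A : I -> set T) :
  measurable D -> (forall i, measurable (A i)) ->
  (\int[P]_(x in D) (\sum_i c i * \1_(A i) x) =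
   \sum_i c i * fine (P (A i `&` D)))%R.
Proof.
move=> mD mA.
have iA i : P.-integrable D (EFin \o (\1_(A i) : T -> R)).
  by apply: integrableS (integrable_indic P (mA i)).
rewrite /Rintegral; under eq_integral do rewrite -sumEFin.
rewrite integral_sum//=; last first.
  by move=> i; exact: (integrableZl mD (c i) (iA i)).
have intA i : (\int[P]_(x in D) (c i * \1_(A i) x)%:E)%E =
    (c i * fine (P (A i `&` D)))%:E.
  under eq_integral do rewrite EFinM.
  rewrite (integralZl mD (iA i)) integral_indic// EFinM fineK//.
  by rewrite fin_num_measure//; exact: measurableI.
by under eq_bigr do rewrite intA; rewrite sumEFin.
Qed.

Lemma cvg_Rintegral_unit d (T : measurableType d) (R : realType)
    (P : probability T R) (D : set T) (f_ : nat -> T -> R) (f : T -> R) :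
  measurable D -> (forall m, measurable_fun D (f_ m)) ->
  (forall m x, D x -> 0 <= f_ m x <= 1) ->
  (forall x, D x -> f_ ^~ x @ \oo --> f x) ->
  (\int[P]_(x in D) f_ m x)%R @[m --> \oo] --> (\int[P]_(x in D) f x)%R.
Proof.
move=> mD mf f01 ff.
have [] := @dominated_convergence _ _ _ P D mD (fun m => EFin \o f_ m)
    (EFin \o f) (cst 1%E).
- by move=> m; exact/measurable_EFinP.
- exact/measurable_EFinP/(measurable_fun_cvg mf).
- by apply: aeW => x Dx; apply: cvg_EFin; [exact: nearW|exact: ff].
- exact: finite_measure_integrable_cst.
- apply: aeW => x m Dx; rewrite /= lee_fin.
  by have /andP[f0 f1] := f01 m x Dx; rewrite ger0_norm.
move=> intf _ cvgf; apply: fine_cvg.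
by rewrite fineK//; exact: integrable_fin_num.
Qed.

(** * Finite limits and step-function approximation of the exponential *)

Lemma cvg_prodr (R : realType) (I : finType) (Q : pred I)
    (f_ : I -> nat -> R) (l : I -> R) :
  (forall i, Q i -> f_ i @ \oo --> l i) ->
  \prod_(i | Q i) f_ i m @[m --> \oo] --> \prod_(i | Q i) l i.
Proof. by move=> fl; apply: cvg_big => //; exact: mul_continuous. Qed.

Lemma cvg_sumr (R : realType) (I : finType) (Q : pred I)
    (f_ : I -> nat -> R) (l : I -> R) :
  (forall i, Q i -> f_ i @ \oo --> l i) ->
  \sum_(i | Q i) f_ i m @[m --> \oo] --> \sum_(i | Q i) l i.
Proof. by move=> fl; apply: cvg_big => //; exact: add_continuous. Qed.

(** Only indicators of lower half-lines are combined, since these are the events whose joint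
    probabilities the cdf gives. *)
Definition stepf {R : realType} (L : nat) (c a : nat -> R) (x : R) : R :=
  \sum_(l < L) c l * (x <= a l)%R%:R.

(** The sum counts the integers from 1 to [M] that are at most [y]; as [y] does not exceed [M], it
    is the integer part of [y]. *)
Lemma sum_lower_levels (R : realType) M (y : R) : 0 <= y <= M%:R ->
  y - 1 <= \sum_(l < M) (l.+1%:R <= y)%R%:R <= y.
Proof.
move=> /andP[y0]; elim: M => [|M IHM] yM.
  by rewrite big_ord0 y0 andbT; lra.
rewrite big_ord_recr/=; case: (leP y M%:R) => [yleM|Mlty].
  have -> : (M.+1%:R <= y) = false.
    by apply/negbTE; rewrite -ltNge (le_lt_trans yleM)// ltr_nat.
  by rewrite addr0 IHM.
rewrite (eq_bigr (fun=> 1)) => [|l _]; last first.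
  by rewrite (le_trans _ (ltW Mlty))// ler_nat.
rewrite sumr_const card_ord; move: yM; rewrite -natr1.
by case: (leP (M%:R + 1) y) => /= ? ?; apply/andP; split; lra.
Qed.

(** For t > 0 and h = exp(-t x), the approximation is the integer part of (m + 1) h divided by m +
    1, hence below h by at most 1 / (m + 1). *)
Lemma expR_stepf_approx (R : realType) (t : R) : 0 <= t ->
  exists L : nat -> nat, exists c : nat -> nat -> R, exists a : nat -> nat -> R,
  forall x, 0 < x ->
    (forall m, 0 <= stepf (L m) (c m) (a m) x <= 1) /\
    stepf (L m) (c m) (a m) x @[m --> \oo] --> expR (- t * x).
Proof.
rewrite le_eqVlt => /predU1P[<-|t0].
  (* For t = 0 the thresholds used below would divide by zero; here the single indicator of x <= m
     is eventually 1. *)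
  exists (fun=> 1%N), (fun _ _ => 1), (fun m _ => m%:R) => x x0.
  have stepE m : stepf 1 (fun=> 1) (fun=> m%:R) x = (x <= m%:R)%R%:R.
    by rewrite /stepf big_ord_recl big_ord0 mul1r addr0.
  split=> [m|]; first by rewrite stepE; case: (x <= _)%R; rewrite ?lexx ?ler01.
  rewrite oppr0 mul0r expR0; apply: cvg_near_cst.
  by near=> m; rewrite stepE (_ : x <= m%:R)//; near: m; exact: nbhs_infty_ger.
(* The threshold solves exp(-t x) = (l + 1) / (m + 1); as the exponential decreases, x lies at or
   below it exactly when l + 1 <= (m + 1) h. *)
exists (fun m => m.+1), (fun m _ => m.+1%:R^-1),
  (fun m l => - ln (l.+1%:R / m.+1%:R) / t) => x x0.
set h := expR _.
have h0 : 0 < h by exact: expR_gt0.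
have h1 : h <= 1 by rewrite -expR0 ler_expR; nra.
have stepE m : stepf m.+1 (fun=> m.+1%:R^-1)
    (fun l => - ln (l.+1%:R / m.+1%:R) / t) x =
    m.+1%:R^-1 * \sum_(l < m.+1) (l.+1%:R <= m.+1%:R * h)%R%:R.
  rewrite mulr_sumr; apply: eq_bigr => l _; congr (_ * (nat_of_bool _)%:R).
  have q0 : 0 < l.+1%:R / m.+1%:R :> R by rewrite divr_gt0.
  rewrite ler_pdivlMr// lerNr -[RHS]ler_pdivrMl// [_^-1 * _]mulrC.
  by rewrite -{2}(lnK q0) ler_expR mulNr [t * x]mulrC.
have bnd m : h - m.+1%:R^-1 <= stepf m.+1 (fun=> m.+1%:R^-1)
    (fun l => - ln (l.+1%:R / m.+1%:R) / t) x <= h.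
  rewrite stepE; have m0 : 0 < m.+1%:R :> R by [].
  have : 0 <= m.+1%:R * h <= m.+1%:R.
    apply/andP; split; first exact/ltW/mulr_gt0.
    by rewrite ler_piMr// ltW.
  move=> /sum_lower_levels/andP[lo up].
  by rewrite ler_pdivrMl// up andbT ler_pdivlMl// mulrBr mulfV//.
split=> [m|].
  have /andP[_ up] := bnd m; rewrite (le_trans up h1) andbT stepE.
  by rewrite mulr_ge0// ?invr_ge0// sumr_ge0.
apply: (@squeeze_cvgr _ _ _ _ (fun m => h - harmonic m) (cst h)).
- by apply: nearW => m; exact: bnd.
- rewrite -[X in _ --> X]subr0.
  by apply: cvgB; [exact: cvg_cst|exact: cvg_harmonic].
- exact: cvg_cst.
Unshelve. all: by end_near. Qed.

Lemma measurable_stepf (R : realType) L (c a : nat -> R) :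
  measurable_fun setT (stepf L c a).
Proof.
apply: (eq_measurable_fun (fun x => \sum_(l < L) c l * \1_`]-oo, a l] x)).
  move=> x _; apply: eq_bigr => l _; rewrite indicE.
  congr (_ * (nat_of_bool _)%:R).
  by apply/idP/idP; rewrite inE/= in_itv.
by apply: measurable_sum => l; apply: measurable_funM.
Qed.

(** * Order statistics on the product space and the joint law of [N] and the claims *)

Lemma measurable_ord_event d (T : measurableType d) (A : set T) (b : bool) :
  measurable A ->
  measurable [set w : T * T | if b then A w.1 /\ A w.2 else A w.1 \/ A w.2].
Proof.
move=> mA.
have mA1 : measurable (A `*` [set: T]) by exact: measurableX.
have mA2 : measurable ([set: T] `*` A) by exact: measurableX.
case: b.
  rewrite (_ : [set w | _] = (A `*` [set: T]) `&` ([set: T] `*` A)).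
    exact: measurableI.
  by apply/seteqP; split=> w /=; tauto.
rewrite (_ : [set w | _] = (A `*` [set: T]) `|` ([set: T] `*` A)).
  exact: measurableU.
by apply/seteqP; split=> w /=; tauto.
Qed.

(** Under [P \x P] the two coordinates are independent, so this realizes X_[1] or X_[2] for the
    generic claim [X 1]. *)
Definition ordX {T : Type} {R : realType} (X : nat -> T -> R) (b : bool)
    (w : T * T) : R :=
  if b then Num.max (X 1 w.1) (X 1 w.2) else Num.min (X 1 w.1) (X 1 w.2).

Section CollectiveRisk.
Context d (T : measurableType d) (R : realType) (P : probability T R).
Context (N : T -> nat) (X : nat -> T -> R).
Context (mN : forall n, measurable (N @^-1` [set n])).
Context (mX : forall j, measurable_fun setT (X j)).

Let measurable_N_preimage (A : set nat) : measurable (N @^-1` A).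
Proof.
have -> : N @^-1` A = \bigcup_(n in A) (N @^-1` [set n]).
  apply/seteqP; split=> w /=; first by exists (N w).
  by case=> n An /= ->.
by apply: bigcup_measurable => n _; exact: mN.
Qed.

Let measurable_X_le j (a : R) : measurable [set w | X j w <= a].
Proof.
by rewrite -[X in measurable X]setTI; apply: measurable_fun_le.
Qed.

Lemma measurable_all_le n (x : 'I_n -> R) :
  measurable [set w | forall j : 'I_n, X j.+1 w <= x j].
Proof.
rewrite (_ : [set w | _] =
    \bigcap_(j in [set: 'I_n]) [set w | X j.+1 w <= x j]).
  by apply: fin_bigcap_measurable => // j _; exact: measurable_X_le.
by apply/seteqP; split=> w /= Xx j; [move=> _|]; exact: Xx.
Qed.

Lemma gammaN_cdfN n : gammaN P N n.+1 = cdfN P N n.+1 - cdfN P N n.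
Proof.
rewrite /gammaN (_ : N @^-1` _ =
    [set w | (N w <= n.+1)%N] `\` [set w | (N w <= n)%N]); last first.
  by apply/seteqP; split=> w /=; [move=> ->; split; lia|case; lia].
rewrite fine_probabilityD//.
- exact: (measurable_N_preimage [set m | (m <= n.+1)%N]).
- exact: (measurable_N_preimage [set m | (m <= n)%N]).
- by move=> w /=; exact: leqW.
Qed.

(** The order statistic is integer-valued, so its mass at n + 1 is an increment of its cdf, which
    [ordcdf] expresses through that of [N]. *)
Lemma gammaNord_ordcdf b n :
  gammaNord P N b n.+1 = ordcdf b (cdfN P N n.+1) - ordcdf b (cdfN P N n).
Proof.
pose A k := [set w | (N w <= k)%N].
have mA k : measurable (A k).
  exact: (measurable_N_preimage [set m | (m <= k)%N]).
pose B k : set (T * T) :=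
  [set w | if b then A k w.1 /\ A k w.2 else A k w.1 \/ A k w.2].
have BE k : B k = [set w | ((if b then maxn (N w.1) (N w.2)
                             else minn (N w.1) (N w.2)) <= k)%N].
  rewrite /B/A; clear B; case: b; apply/seteqP; split=> w /=;
    rewrite ?geq_max ?geq_min.
  - by case=> -> ->.
  - by move/andP.
  - by move/orP.
  - by move/orP.
have mB k : measurable (B k) by exact: measurable_ord_event.
rewrite /gammaNord (_ : [set w | _ = _] = B n.+1 `\` B n); last first.
  rewrite !BE; apply/seteqP; split=> w /=; first by move=> ->; split; lia.
  by case; lia.
rewrite fine_probabilityD//; last by rewrite !BE => w /=; exact: leqW.
by rewrite !probability_ordcdf.
Qed.

Let stepf_indic b L (c a : nat -> R) (w : T * T) :
  stepf L c a (ordX X b w) =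
  \sum_(l < L) c l * \1_[set w | if b then X 1 w.1 <= a l /\ X 1 w.2 <= a l
                                 else X 1 w.1 <= a l \/ X 1 w.2 <= a l] w.
Proof.
apply: eq_bigr => l _; rewrite indicE; congr (_ * (nat_of_bool _)%:R).
rewrite /ordX; case: b; rewrite ?ge_max ?ge_min; apply/idP/idP.
- by move=> /andP[? ?]; rewrite inE.
- by rewrite inE/= => -[-> ->].
- by move=> /orP ?; rewrite inE.
- by rewrite inE/= => /orP.
Qed.

Let measurable_ordX_le (b : bool) (a : R) :
  measurable [set w : T * T | if b then X 1 w.1 <= a /\ X 1 w.2 <= a
                              else X 1 w.1 <= a \/ X 1 w.2 <= a].
Proof.
exact: (measurable_ord_event _ _ [set w | X 1 w <= a] b).
Qed.

Lemma measurable_ordX b : measurable_fun setT (ordX X b).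
Proof.
have mX1 : measurable_fun setT (fun w : T * T => X 1 w.1).
  exact: (measurableT_comp (mX 1) measurable_fst).
have mX2 : measurable_fun setT (fun w : T * T => X 1 w.2).
  exact: (measurableT_comp (mX 1) measurable_snd).
by case: b; [exact: measurable_maxr|exact: measurable_minr].
Qed.

Lemma Rintegral_stepf_ord b L (c a : nat -> R) :
  (\int[(P \x P)%E]_w stepf L c a (ordX X b w) =
   \sum_(l < L) c l * ordcdf b (cdfX P X (a l)))%R.
Proof.
under eq_Rintegral do rewrite stepf_indic.
rewrite (@Rintegral_sum_indic _ _ _ (P \x P)%E)//.
apply: eq_bigr => l _; rewrite setIT; congr (_ * _).
exact: (probability_ordcdf _ _ _ P [set w | X 1 w <= a l]).
Qed.

(** Taking the increment of the joint cdf in [N] affects only the factor of coordinate 0 in each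
    mixture term, where it produces [gammaNord]. *)
Lemma joint_fgm_mixture (theta : seq nat -> R) n (x : 'I_n.+1 -> R) :
  (forall k y, jointcdf P N X k y =
     fgm_copula theta (margvec P N X k (y : 'I_n.+1 -> R))) ->
  fine (P ([set w | forall j : 'I_n.+1, X j.+1 w <= x j]
           `&` N @^-1` [set n.+1])) =
  \sum_(i : {ffun 'I_n.+2 -> bool})
     fgm_pmf theta i * gammaNord P N (i ord0) n.+1 *
     \prod_(j < n.+1) ordcdf (i (lift ord0 j)) (cdfX P X (x j)).
Proof.
move=> cdfE.
pose B k := [set w | (N w <= k)%N /\ forall j : 'I_n.+1, X j.+1 w <= x j].
have mB k : measurable (B k).
  apply: measurableI; last exact: measurable_all_le.
  exact: (measurable_N_preimage [set m | (m <= k)%N]).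
have -> : [set w | forall j : 'I_n.+1, X j.+1 w <= x j] `&` N @^-1` [set n.+1] =
    B n.+1 `\` B n.
  apply/seteqP; split=> w /=.
    by case=> Xx Nn; rewrite /B/= Nn; split=> // -[]; rewrite ltnn.
  case=> -[Nn Xx] nB; split=> //; apply/eqP; rewrite eqn_leq Nn/= ltnNge.
  by apply/negP => Nn'; apply: nB.
rewrite fine_probabilityD//; last by move=> w [Nn Xx]; split=> //; exact: leqW.
have := cdfE n.+1 x; rewrite /jointcdf -/(B _) => ->.
have := cdfE n x; rewrite /jointcdf -/(B _) => ->.
rewrite !fgm_copula_mixture -sumrB; apply: eq_bigr => i _.
have mixE k : \prod_m ordcdf (i m) (margvec P N X k x m) =
    ordcdf (i ord0) (cdfN P N k) *
    \prod_(j < n.+1) ordcdf (i (lift ord0 j)) (cdfX P X (x j)).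
  rewrite [LHS]big_ord_recl; congr (_ * _).
    by rewrite /margvec unlift_none.
  by apply: eq_bigr => j _; rewrite /margvec liftK.
by rewrite !mixE gammaNord_ordcdf; ring.
Qed.

End CollectiveRisk.

(** * From step functions to the Laplace transform on each event N = n + 1 *)

Section LaplaceTransform.
Context d (T : measurableType d) (R : realType) (P : probability T R).
Context (N : T -> nat) (X : nat -> T -> R).
Context (mN : forall n, measurable (N @^-1` [set n])).
Context (mX : forall j, measurable_fun setT (X j)).
Context (Xpos : forall j w, (1 <= j)%N -> 0 < X j w).

(** The product of sums expands over the maps [f] that choose one threshold per claim. Each term is
    the indicator of an event covered by [joint_fgm_mixture]; after the sums are exchanged, the sum
    over [f] factorizes again. *)
Lemma Rintegral_prod_stepf (theta : seq nat -> R) n L (c a : nat -> R) :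
  (forall k x, jointcdf P N X k x =
     fgm_copula theta (margvec P N X k (x : 'I_n.+1 -> R))) ->
  (\int[P]_(w in N @^-1` [set n.+1]) \prod_(j < n.+1) stepf L c a (X j.+1 w) =
   \sum_(i : {ffun 'I_n.+2 -> bool})
     fgm_pmf theta i * gammaNord P N (i ord0) n.+1 *
     \prod_(j < n.+1) \int[(P \x P)%E]_w
        stepf L c a (ordX X (i (lift ord0 j)) w))%R.
Proof.
move=> cdfE.
pose A (f : {ffun 'I_n.+1 -> 'I_L}) :=
  [set w | forall j : 'I_n.+1, X j.+1 w <= a (f j)].
have prodE w : \prod_(j < n.+1) stepf L c a (X j.+1 w) =
    \sum_(f : {ffun 'I_n.+1 -> 'I_L}) (\prod_j c (f j)) * \1_(A f) w.
  rewrite /stepf bigA_distr_bigA/=; apply: eq_bigr => f _.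
  rewrite big_split/=; congr (_ * _); rewrite indicE.
  have [/set_mem Afw|/negP Afw] := boolP (w \in A f).
    by rewrite big1// => j _; rewrite Afw.
  have /existsNP[j /negP/negbTE nj] : ~ A f w by move=> /mem_set.
  by rewrite (bigD1 j)//= nj mul0r.
under eq_Rintegral do rewrite prodE.
rewrite Rintegral_sum_indic//; last first.
  by move=> f; exact: measurable_all_le.
under [LHS]eq_bigr => f _.
  rewrite (joint_fgm_mixture _ _ _ _ _ _ mN mX _ _ _ cdfE) mulr_sumr; over.
rewrite exchange_big/=; apply: eq_bigr => i _.
under [in RHS]eq_bigr do rewrite (Rintegral_stepf_ord _ _ _ _ _ mX).
rewrite bigA_distr_bigA/= mulr_sumr; apply: eq_bigr => f _.
by rewrite [X in _ = _ * X]big_split mulrCA.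
Qed.

(** Both sides are limits of the identity for step functions, by dominated convergence with bound 1;
    limits are unique. *)
Lemma Rintegral_prod_expR (theta : seq nat -> R) n (t : R) : 0 <= t ->
  (forall k x, jointcdf P N X k x =
     fgm_copula theta (margvec P N X k (x : 'I_n.+1 -> R))) ->
  (\int[P]_(w in N @^-1` [set n.+1]) \prod_(j < n.+1) expR (- t * X j.+1 w) =
   \sum_(i : {ffun 'I_n.+2 -> bool})
     fgm_pmf theta i * gammaNord P N (i ord0) n.+1 *
     \prod_(j < n.+1) LXord P X (i (lift ord0 j)) t)%R.
Proof.
move=> t0 cdfE.
have [L [c [a apx]]] := expR_stepf_approx R t t0.
pose g m := stepf (L m) (c m) (a m).
have ordpos b w : 0 < ordX X b w.
  by rewrite /ordX; case: b; rewrite ?lt_max ?lt_min !Xpos.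
have cvgL b : (\int[(P \x P)%E]_w g m (ordX X b w))%R @[m --> \oo] -->
    LXord P X b t.
  apply: (cvg_Rintegral_unit _ _ _ (P \x P)%E setT) => //.
  - move=> m; apply: (measurableT_comp (measurable_stepf _ _ _ _)).
    exact: measurable_ordX.
  - by move=> m w _; case: (apx _ (ordpos b w)) => bnd _; exact: bnd.
  - by move=> w _; case: (apx _ (ordpos b w)).
have cvgl : (\int[P]_(w in N @^-1` [set n.+1])
    \prod_(j < n.+1) g m (X j.+1 w))%R @[m --> \oo] -->
    (\int[P]_(w in N @^-1` [set n.+1])
    \prod_(j < n.+1) expR (- t * X j.+1 w))%R.
  apply: cvg_Rintegral_unit => //.
  - move=> m; apply: measurable_prod => j _; apply: measurable_funTS.
    exact: (measurableT_comp (measurable_stepf _ _ _ _)).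
  - move=> m w _; have bnd j := (apx _ (Xpos j.+1 w isT)).1 m.
    apply/andP; split; first by apply: prodr_ge0 => j _; case/andP: (bnd j).
    by apply: prodr_ile1 => j _; exact: bnd.
  - by move=> w _; apply: cvg_prodr => j _; exact: (apx _ (Xpos j.+1 w isT)).2.
apply: (cvg_unique (@Rhausdorff R) cvgl).
rewrite /mkset; under eq_fun do rewrite (Rintegral_prod_stepf _ _ _ _ _ cdfE).
by apply: cvg_sumr => i _; apply: cvgMr; apply: cvg_prodr => j _; exact: cvgL.
Qed.

Lemma integral_layer (theta : seq nat -> R) n (t : R) : 0 <= t ->
  (forall k, (1 <= k)%N -> le_supAN P N k ->
     forall (m : nat) (x : 'I_k -> R),
       jointcdf P N X m x = fgm_copula theta (margvec P N X m x)) ->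
  (\int[P]_(w in N @^-1` [set n.+1]) (expR (- t * aggS N X w))%:E)%E =
  (\sum_(i : {ffun 'I_n.+2 -> bool})
     fgm_pmf theta i * gammaNord P N (i ord0) n.+1 *
     \prod_(j < n.+2 | j != ord0) LXord P X (i j) t)%:E.
Proof.
move=> t0 cdfE.
have prodE w : N w = n.+1 ->
    expR (- t * aggS N X w) = \prod_(j < n.+1) expR (- t * X j.+1 w).
  by move=> Nw; rewrite /aggS Nw mulr_sumr expR_sum.
have mprod : measurable_fun setT
    (fun w => \prod_(j < n.+1) expR (- t * X j.+1 w)).
  apply: measurable_prod => j _; apply: measurableT_comp => //.
  exact: measurable_funM.
rewrite (eq_integral
    (EFin \o (fun w => \prod_(j < n.+1) expR (- t * X j.+1 w))));
  last by move=> w /set_mem/= Nw; rewrite prodE.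
have [g0|gpos] := eqVneq (gammaN P N n.+1) 0.
  have N0 : P (N @^-1` [set n.+1]) = 0%E.
    by rewrite -[LHS]fineK ?fin_num_measure//; congr EFin.
  rewrite null_set_integral//; last exact/measurable_EFinP/measurable_funTS.
  rewrite big1// => i _; rewrite gammaNord_ordcdf//.
  have -> : cdfN P N n.+1 = cdfN P N n.
    by apply/eqP; rewrite -subr_eq0 -gammaN_cdfN// g0.
  by rewrite subrr mulr0 mul0r.
have supn : le_supAN P N n.+1.
  by exists n.+1; rewrite leqnn lt_def gpos fine_ge0.
(* The coordinates other than 0 are the [lift ord0 j]; coordinate 0 contributes a factor 1. *)
under eq_bigr do rewrite big_mkcond big_ord_recl/= mul1r.
rewrite -(Rintegral_prod_expR _ _ _ t0 (cdfE n.+1 isT supn)) fineK//.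
apply: integrable_fin_num => //; apply: measurable_bounded_integrable => //.
- by rewrite ltey_eq fin_num_measure.
- exact: measurable_funTS.
(* The product is at most 1 because t is nonnegative and the claims are positive. *)
- exists 1; split=> // M M1 w _ /=; rewrite ger0_norm ?prodr_ge0//.
  apply: (le_trans _ (ltW M1)); apply: prodr_ile1 => j _.
  rewrite expR_ge0/= -expR0 ler_expR mulNr oppr_le0 mulr_ge0//.
  exact/ltW/Xpos.
Qed.

End LaplaceTransform.

(** * Summation over the values of [N] *)

Theorem mainTheorem12 (d : measure_display) (T : measurableType d) (R : realType)
  (P : probability T R) (N : T -> nat) (X : nat -> T -> R)
  (theta : seq nat -> R) (t : R) :
  (* N is a random variable with values in N_0 *)
  (forall n, measurable (N @^-1` [set n])) ->
  (* the X_j are strictly positive, identically distributed random variables *)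
  (forall j, measurable_fun setT (X j)) ->
  (forall j w, (1 <= j)%N -> 0 < X j w) ->
  (forall j x, (1 <= j)%N -> P [set w | X j w <= x] = P [set w | X 1 w <= x]) ->
  (* (N, X) in aleph^{FGM}: joint cdf of (N, X_1..X_k) is the FGM copula C_k
     with (consistent) parameters theta, for every 1 <= k <= sup A_N *)
  (forall k, (1 <= k)%N -> le_supAN P N k -> fgm_admissible theta k) ->
  (forall k, (1 <= k)%N -> le_supAN P N k ->
     forall (n : nat) (x : 'I_k -> R),
       jointcdf P N X n x = fgm_copula theta (margvec P N X n x)) ->
  (* (N, X) in aleph^{FGM*}: exchangeability *)
  (forall k, (1 <= k)%N -> le_supAN P N k ->
     forall (pi : {perm 'I_k}) (n : nat) (x : 'I_k -> R),
       jointcdf P N X n x = jointcdf_perm P N X pi n x) ->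
  0 <= t ->
  (LS P N X t =
     ((gammaN P N 0)%:E +
      \sum_(1 <= n <oo)
        (\sum_(i : {ffun 'I_n.+1 -> bool})
           fgm_pmf theta i * gammaNord P N (i ord0) n *
           \prod_(j < n.+1 | j != ord0) LXord P X (i j) t)%:E)%E)
  /\
  (LS P N X t =
     ((gammaN P N 0)%:E +
      \sum_(1 <= n <oo)
        (\sum_(b : bool) gammaNord P N b n *
           \sum_(k < n.+1) fgm_PrIK theta n b k *
              LXord P X false t ^+ (n - k) * LXord P X true t ^+ k)%:E)%E).
Proof.
move=> mN mX Xpos _ _ cdfE _ t0.
have LSE : LS P N X t = ((gammaN P N 0)%:E +
      \sum_(1 <= n <oo)
        (\sum_(i : {ffun 'I_n.+1 -> bool})
           fgm_pmf theta i * gammaNord P N (i ord0) n *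
           \prod_(j < n.+1 | j != ord0) LXord P X (i j) t)%:E)%E.
  (* The events N = n partition the space, so the integral of the nonnegative integrand is a series
     over n. *)
  have NT : \bigcup_n (N @^-1` [set n]) = setT.
    by apply/seteqP; split=> // w _; exists (N w).
  rewrite /LS -NT ge0_integral_bigcup//.
  - rewrite nneseries_recl//; last first.
      by move=> n _; apply: integral_ge0 => w _; rewrite lee_fin expR_ge0.
    congr (_ + _)%E.
      (* On N = 0 the aggregate sum is empty and the integrand is 1. *)
      rewrite (eq_integral (cst 1%E)); last first.
        move=> w /set_mem/= Nw.
        by rewrite /aggS Nw big_ord0 mulr0 expR0.
      rewrite integral_cst// mul1e /gammaN fineK//.
      by rewrite fin_num_measure.
    apply: congr_lim; apply/funext => m; apply: eq_big_nat => -[//|n] _.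
    exact: integral_layer.
  - apply/measurable_fun_bigcup => // n.
    apply: (eq_measurable_fun
      (fun w => (expR (- t * \sum_(j < n) X j.+1 w))%:E)).
      by move=> w /set_mem/= Nw; rewrite /aggS Nw.
    apply/measurable_EFinP/measurable_funTS/measurableT_comp => //.
    by apply: measurable_funM => //; exact: measurable_sum.
  - by move=> j k _ _ [w [/= <- <-]].
split=> //; rewrite LSE; congr (_ + _)%E.
apply: congr_lim; apply/funext => m; apply: eq_bigr => n _; congr EFin.
(* Each term is regrouped by I_0 and K_n, with a and b the transforms of X_[1] and X_[2]. *)
rewrite -sum_fgm_pmf_PrIK; apply: eq_bigr => i _; congr (_ * _).
by apply: eq_bigr => j _; case: (i j).
Qed.
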